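(* Let $n\ge 1$, let $A, B, C\in M_n(\mathbb{C})$ be positive semi-definite matrices, and let $r \in \{1\} \cup [2, \infty)$. Then for any generalized matrix function $d=d_\chi^G$ on $M_n(\mathbb{C})$, $$d(A+B+C)^r + d(A)^r + d(B)^r + d(C)^r \ge d(A+B)^r + d(A+C)^r + d(B+C)^r.$$
   Context: $M_n(\mathbb{C})$ denotes the $n\times n$ complex matrices; positive semi-definite matrices are Hermitian. Let $G$ be a subgroup of the symmetric group $S_n$ and let $\chi$ be a linear (i.e. degree-one complex) character of $G$. The generalized matrix function associated with $G$ and $\chi$ is $d_\chi^G(A)=\sum_{\sigma\in G}\chi(\sigma)\prod_{i=1}^n a_{i\,\sigma(i)}$ for $A=(a_{ij})\in M_n(\mathbb{C})$. On positive semi-definite matrices its values are nonnegative real numbers, so real powers make sense. *)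

(* Defs.v *)
From HB Require Import structures.
From mathcomp Require Import all_boot all_order all_algebra all_fingroup.
From mathcomp Require Import sesquilinear spectral complex.
From mathcomp Require Import boolp reals exp.

Set Implicit Arguments.
Unset Strict Implicit.
Unset Printing Implicit Defensive.

Import Order.TTheory GRing.Theory Num.Theory.
Local Open Scope sesquilinear_scope.
Local Open Scope ring_scope.

(* The order on the complex field [R[i]] is partial: [0 <= z] says that [z] is
   real and nonnegative. *)
Definition psdmx (R : realType) (n : nat) (A : 'M[R[i]]_n) : Prop :=
  A \is hermsymmx /\ forall x : 'cV[R[i]]_n, 0 <= (x ^t* *m A *m x) 0 0.

(* A degree-one character is a homomorphism from [G] to the multiplicative
   group of nonzero complex numbers. It is represented by a total function
   whose values outside [G] are irrelevant. *)
Definition linear_character (R : realType) (gT : finGroupType)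
    (G : {group gT}) (chi : gT -> R[i]) : Prop :=
  {in G, forall s, chi s != 0} /\
  {in G &, {morph chi : s t / (s * t)%g >-> s * t}}.

Definition gen_matrix_fun (R : realType) (n : nat) (G : {group 'S_n})
    (chi : 'S_n -> R[i]) (A : 'M[R[i]]_n) : R[i] :=
  \sum_(s in G) chi s * \prod_(i < n) A i (s i).

(* Main.v *)
(** Put [v = \sum_(s in G) chi s *: (e_(s 0) (x) ... (x) e_(s (n - 1)))]. Since [chi] is unitary
on [G], reindexing gives [#|G| * d X = <v, X^(x)n v>]. Expanding the tensor power of a
sum of some of the matrices [M 0 = A], [M 1 = B], [M 2 = C] writes [d] of that sum as a sum,
over the words [f : 'I_n -> 'I_3] in the letters present, of the weights
[<v, (M (f 0) (x) ... (x) M (f (n - 1))) v> / #|G|], which are nonnegative because a tensor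
product of Gram matrices is a Gram matrix. Comparing which words occur gives
[d A + d B <= d (A + B)], its analogues, and the case [r = 1]. For [r >= 2] what remains is a
Hlawka inequality for [t `^ r] on the nonnegative reals. *)
Require Import Defs.
From HB Require Import structures.
From mathcomp Require Import all_boot all_order all_algebra all_fingroup.
From mathcomp Require Import sesquilinear spectral complex.
From mathcomp Require Import boolp reals exp.
From mathcomp Require Import lra ring classical_sets interval_inference convex.
From mathcomp Require Import topology normedtype derive realfun hoelder.

Set Implicit Arguments.
Unset Strict Implicit.
Unset Printing Implicit Defensive.

Import Order.TTheory GRing.Theory Num.Theory.
Import numFieldNormedType.Exports.
Local Open Scope sesquilinear_scope.
Local Open Scope ring_scope.

(** * Convexity and a Hlawka inequality for real powers *)

Lemma powR_convexW (R : realType) (p t x y : R) : 1 <= p ->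
  0 <= x -> 0 <= y -> 0 <= t <= 1 ->
  (t * x + (1 - t) * y) `^ p <= t * x `^ p + (1 - t) * y `^ p.
Proof.
move=> p1 x0 y0 /andP[t0 t1].
by apply: (convex_powR p1 (Itv01 t0 t1)); rewrite ?inE/= ?in_itv/= ?x0 ?y0.
Qed.

(** [v + x] and [u] lie between [v] and [u + x] and have the same sum as these endpoints, so they
    are complementary convex combinations of them. *)
Lemma powR_increment_le (R : realType) (p u v x : R) : 1 <= p ->
  0 <= v -> v <= u -> 0 <= x ->
  (v + x) `^ p + u `^ p <= (u + x) `^ p + v `^ p.
Proof.
move=> p1 v0 vu x0.
have [L0|L0] := eqVneq (u + x - v) 0.
  have -> : u = v by lra.
  by [].
have Lp : 0 < u + x - v by rewrite lt_def L0; lra.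
pose t := x / (u + x - v).
have tL : t * (u + x - v) = x by rewrite /t divfK.
have t0 : 0 <= t by rewrite /t divr_ge0// ltW.
have t1 : t <= 1 by rewrite /t ler_pdivrMr// mul1r; lra.
have ux0 : 0 <= u + x by lra.
have h1 := @powR_convexW R p t (u + x) v p1 ux0 v0 (introT andP (conj t0 t1)).
have h2 := @powR_convexW R p t v (u + x) p1 v0 ux0 (introT andP (conj t0 t1)).
have e1 : t * (u + x) + (1 - t) * v = v + x by rewrite -[in RHS]tL; ring.
have e2 : t * v + (1 - t) * (u + x) = u.
  by transitivity (u + x - t * (u + x - v)); [ring|rewrite tL; ring].
rewrite e1 in h1; rewrite e2 in h2.
apply: le_trans (lerD h1 h2) _.
by rewrite le_eqVlt; apply/orP; left; apply/eqP; ring.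
Qed.

(* Equality holds at [c = 0], and the derivative in [c] is nonnegative because the
   increments of [t `^ (r - 1)] grow with [t]. *)
Lemma powR_hlawka (R : realType) (r a b c : R) : 2 <= r ->
  0 <= a -> 0 <= b -> 0 <= c ->
  (a + b) `^ r + (a + c) `^ r + (b + c) `^ r
    <= (a + b + c) `^ r + a `^ r + b `^ r + c `^ r.
Proof.
move=> r2 a0 b0 c0.
have rn0 : r != 0 by rewrite gt_eqF//; lra.
have [->|an0] := eqVneq a 0; first by rewrite !add0r powR0//; lra.
have [->|bn0] := eqVneq b 0; first by rewrite addr0 add0r powR0//; lra.
have [->|cn0] := eqVneq c 0; first by rewrite !addr0 powR0//; lra.
have ap : 0 < a by rewrite lt_def an0.
have bp : 0 < b by rewrite lt_def bn0.
have cp : 0 < c by rewrite lt_def cn0.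
pose f (k x : R) := (k + x) `^ r.
have df (k x : R) : 0 < k + x -> is_derive x (1 : R) (f k) (r * (k + x) `^ (r - 1)).
  move=> kx.
  have h := is_derive1_powR r kx.
  have h2 : is_derive x (1 : R) (fun y : R => k + y) (0 + 1).
    exact: is_deriveD.
  have := is_derive1_comp h h2.
  by rewrite add0r mulr1.
(* [psi c - psi 0] is the right side of the claim minus the left side. *)
pose psi x := f (a + b) x + f 0 x - f a x - f b x.
pose dpsi x := r * (a + b + x) `^ (r - 1) + r * (0 + x) `^ (r - 1)
   - r * (a + x) `^ (r - 1) - r * (b + x) `^ (r - 1).
have dp (x : R) : 0 < x -> is_derive x (1 : R) psi (dpsi x).
  move=> x0.
  have := df (a + b) x ltac:(lra); have := df 0 x ltac:(lra).
  have := df a x ltac:(lra); have := df b x ltac:(lra).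
  by move=> *; apply: is_derive_eq.
have cont k x : 0 < k + x -> {for x, continuous (f k)}.
  move=> /df [+ _]; move/derivable1_diffP/differentiable_continuous; exact.
have cpsi : {within `[0, c], continuous psi}%classic.
  apply/(continuous_within_itvP psi cp); split.
  - move=> x; rewrite in_itv/= => /andP[x0 _].
    have [+ _] := dp _ x0.
    by move/derivable1_diffP/differentiable_continuous; exact.
  - have h k : 0 < k -> (f k x @[x --> 0^'+] --> f k 0)%classic.
      by move=> k0; apply: cvg_at_right_filter; apply: cont; rewrite addr0.
    apply: cvgB; last exact: h.
    apply: cvgB; last exact: h.
    apply: cvgD; first by apply: h; lra.
    (* The base of [f 0] vanishes at 0, where [cont] does not apply, so this right limit is taken
       separately. *)
    rewrite /f addr0 powR0//.
    under eq_fun do rewrite add0r.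
    by apply: powR_cvg0; lra.
  - apply: cvg_at_left_filter.
    have [+ _] := dp _ cp.
    by move/derivable1_diffP/differentiable_continuous; exact.
have dp' x : x \in `]0, c[ -> is_derive x (1 : R) psi (dpsi x).
  by rewrite in_itv/= => /andP[x0 _]; exact: dp.
have [x] := MVT cp dp' cpsi; rewrite in_itv/= => /andP[x0 _].
have dx : 0 <= dpsi x.
  (* Here [2 <= r] enters: the increment bound needs [1 <= r - 1]. *)
  have := @powR_increment_le R (r - 1) (a + x) x b ltac:(lra) ltac:(lra) ltac:(lra) b0.
  rewrite /dpsi add0r (addrC x b) (addrAC a x b).
  set p1 := _ `^ _; set p2 := _ `^ _; set p3 := _ `^ _; set p4 := _ `^ _ => h.
  have -> : r * p3 + r * p4 - r * p2 - r * p1 = r * ((p3 + p4) - (p1 + p2)) by ring.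
  by rewrite mulr_ge0//; lra.
rewrite subr0 => e.
have : 0 <= psi c - psi 0 by rewrite e mulr_ge0.
rewrite /psi /f !addr0 add0r powR0//.
lra.
Qed.

(* The increments of [t `^ r] grow with [t], so the slack in the hypotheses can
   only help: it reduces the claim to the case where all of them are equalities. *)
Lemma powR_hlawka_superadditive (R : realType) (r a b c ab ac bc abc : R) :
  r = 1 \/ 2 <= r -> 0 <= a -> 0 <= b -> 0 <= c ->
  a + b <= ab -> a + c <= ac -> b + c <= bc -> ab + ac + bc <= abc + a + b + c ->
  ab `^ r + ac `^ r + bc `^ r <= abc `^ r + a `^ r + b `^ r + c `^ r.
Proof.
move=> hr a0 b0 c0 hab hac hbc habc.
case: hr => [->|r2]; first by rewrite !powRr1; lra.
have r1 : 1 <= r by lra.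
have := @powR_hlawka R r a b c r2 a0 b0 c0.
(* The slacks are added one at a time, ending at [t3], which equals [ab + ac + bc - a - b - c] and
   so is at most [abc]. *)
pose t1 := a + b + c + (ab - (a + b)).
pose t2 := t1 + (ac - (a + c)).
pose t3 := t2 + (bc - (b + c)).
have inc := fun u v x => @powR_increment_le R r u v x r1.
have := inc (a + b + c) (a + b) (ab - (a + b)).
have := inc t1 (a + c) (ac - (a + c)).
have := inc t2 (b + c) (bc - (b + c)).
rewrite -/t1 -/t2 -/t3 !subrKC => i3 i2 i1.
have {}i1 := i1 ltac:(lra) ltac:(lra) ltac:(lra).
have {}i2 := i2 ltac:(lra) ltac:(rewrite /t1; lra) ltac:(lra).
have {}i3 := i3 ltac:(lra) ltac:(rewrite /t2 /t1; lra) ltac:(lra).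
have : t3 `^ r <= abc `^ r.
  by apply: ge0_ler_powR; rewrite ?nnegrE /t3 /t2 /t1; lra.
lra.
Qed.

(** * Gram decompositions and positivity of tensor products *)

Lemma psdmx_gram (R : realType) (n : nat) (A : 'M[R[i]]_n) : psdmx A ->
  exists (P : 'M[R[i]]_n) (w : 'I_n -> R[i]), (forall k, 0 <= w k) /\
    forall i j, A i j = \sum_k w k * ((P k i)^* * P k j).
Proof.
case=> Ah Ap.
have /hermitian_normalmx /orthomx_spectralP := Ah.
set P := spectralmx A; set D := spectral_diag A.
have Pu : P \is unitarymx := spectral_unitarymx A.
rewrite (invmx_unitary Pu) => AE.
exists P, (fun k => D 0 k); split=> [k|i j].
  (* The form at the [k]-th eigenvector gives the [k]-th eigenvalue. *)
  have := Ap (P ^t* *m delta_mx k 0).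
  rewrite {1}AE trmx_mul map_mxM /= map_trmx trmxK -map_mx_comp (map_mx_id (@conjCK _)).
  rewrite -!mulmxA [P *m (_ *m _)]mulmxA (unitarymxP Pu) mul1mx.
  rewrite [P *m (_ *m _)]mulmxA (unitarymxP Pu) mul1mx.
  suff -> : ((delta_mx k 0 : 'cV_n)^t* *m (diag_mx D *m delta_mx k 0) : 'M[R[i]]_1) 0 0 = D 0 k by [].
  rewrite mxE (bigD1 k)//= big1 ?addr0 => [|l lk].
    by rewrite mul_diag_mx !mxE !eqxx rmorph1 mul1r mulr1.
  by rewrite !mxE (negbTE lk) rmorph0 mul0r.
rewrite {1}AE -mulmxA mxE; apply: eq_bigr => k _.
by rewrite mul_diag_mx !mxE; rewrite mulrCA.
Qed.

(** Expanding the Gram sums of all factors, with [f] choosing one index per factor, turns the double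
    sum into a nonnegative combination of the squared moduli of [\sum_(t in S) y f t]. *)
Lemma psd_tensor_form_ge0 (R : realType) (T : finType) (S : {pred T}) (m n : nat)
    (F : 'I_m -> 'M[R[i]]_n) (p : T -> 'I_m -> 'I_n) (x : T -> R[i]) :
  (forall i, psdmx (F i)) ->
  0 <= \sum_(s in S) \sum_(t in S)
         (x s)^* * x t * \prod_i F i (p s i) (p t i).
Proof.
move=> hF; have H i := cid (@psdmx_gram _ _ _ (hF i)).
pose P i := sval (H i).
pose w i := sval (cid (svalP (H i))).
have w0 i k : 0 <= w i k.
  by case: (svalP (cid (svalP (H i)))) => + _; exact.
have FE i j k : F i j k = \sum_l w i l * ((P i l j)^* * P i l k).
  by have [_] := svalP (cid (svalP (H i))); apply.
pose y (f : {ffun 'I_m -> 'I_n}) t := x t * \prod_i P i (f i) (p t i).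
rewrite (_ : \sum_(s in S) _ = \sum_(f : {ffun 'I_m -> 'I_n})
   (\prod_i w i (f i)) * ((\sum_(t in S) y f t)^* * \sum_(t in S) y f t)).
  apply: sumr_ge0 => f _; apply: mulr_ge0; first exact: prodr_ge0.
  by rewrite mulrC mul_conjC_ge0.
have E (f : {ffun 'I_m -> 'I_n}) : (\prod_i w i (f i)) * ((\sum_(t in S) y f t)^* * \sum_(t in S) y f t)
    = \sum_(s in S) \sum_(t in S) (\prod_i w i (f i)) * ((y f s)^* * y f t).
  rewrite rmorph_sum/= big_distrlr/= mulr_sumr.
  by apply: eq_bigr => s _; rewrite mulr_sumr.
under [RHS]eq_bigr do rewrite E.
rewrite [RHS]exchange_big/=; apply: eq_bigr => s _.
rewrite exchange_big/=; apply: eq_bigr => t _.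
under eq_bigr do rewrite FE.
rewrite bigA_distr_bigA/= mulr_sumr; apply: eq_bigr => f _.
rewrite /y rmorphM rmorph_prod !big_split/=.
by rewrite [X in _ = _ * X]mulrACA [RHS]mulrCA.
Qed.

(* The form of the tensor product of the [F i] at the vector [v] of the header. *)
Definition gmf_form (R : realType) (n : nat) (G : {group 'S_n})
    (chi : 'S_n -> R[i]) (F : 'I_n -> 'M[R[i]]_n) : R[i] :=
  \sum_(s in G) \sum_(t in G) (chi s)^* * chi t * \prod_i F i (s i) (t i).

(** * Unitarity of linear characters, and [d] as a tensor form *)

Section Character.
Context (R : realType) (gT : finGroupType) (G : {group gT}) (chi : gT -> R[i]).
Hypothesis hchi : linear_character G chi.

Lemma linear_character1 : chi 1%g = 1.
Proof.
have [n0 /(_ 1%g 1%g (group1 G) (group1 G))] := hchi.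
rewrite mulg1 => /esym/(canRL (mulfK (n0 _ (group1 G)))) ->.
by rewrite mulfV// n0.
Qed.

Lemma linear_characterX s k : s \in G -> chi (s ^+ k)%g = chi s ^+ k.
Proof.
move=> sG; elim: k => [|k IH]; first by rewrite expg0 expr0 linear_character1.
by rewrite expgS exprS hchi.2 ?groupX// IH.
Qed.

(** As [s] has finite order, [chi s] is a root of unity, so its conjugate is its inverse. *)
Lemma conj_linear_character s : s \in G -> (chi s)^* = chi s^-1%g.
Proof.
move=> sG.
have /eqP : `|chi s| ^+ #[s]%g = 1.
  by rewrite -normrX -linear_characterX// expg_order linear_character1 normr1.
rewrite pexpr_eq1 ?order_gt0// => /eqP n1.
apply: (mulfI (hchi.1 s sG)).
rewrite -normCK n1 expr1n -hchi.2 ?groupV//.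
by rewrite mulgV linear_character1.
Qed.

End Character.

(** After replacing [t] by [s * t], the factor [chi s] cancels and reindexing the product by [s]
    removes [s]: each [s] contributes the same value. *)
Lemma gmf_formE (R : realType) (n : nat) (G : {group 'S_n})
    (chi : 'S_n -> R[i]) (X : 'M[R[i]]_n) : linear_character G chi ->
  gmf_form G chi (fun=> X) = #|G|%:R * gen_matrix_fun G chi X.
Proof.
move=> hchi; rewrite /gmf_form -sum1_card natr_sum mulr_suml.
apply: eq_bigr => s sG; rewrite mul1r.
rewrite (reindex_inj (mulgI s))/=.
apply: eq_big => [t|t]; first by rewrite groupMl.
rewrite groupMl// => tG.
rewrite (@conj_linear_character _ _ _ _ hchi)// hchi.2// mulrA -hchi.2 ?groupV//.
rewrite mulVg (@linear_character1 _ _ _ _ hchi) mul1r; congr (_ * _).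
rewrite [RHS](reindex_inj (@perm_inj _ s))/=.
by apply: eq_bigr => i _; rewrite permM.
Qed.


(** * Expansion over words and comparison of their weights *)

Lemma gmf_form_sum (R : realType) (n k : nat) (G : {group 'S_n})
    (chi : 'S_n -> R[i]) (M : 'I_k -> 'M[R[i]]_n) (Q : pred 'I_k) :
  gmf_form G chi (fun=> \sum_(j | Q j) M j) =
  \sum_(f : {ffun 'I_n -> 'I_k} | [forall i, Q (f i)]) gmf_form G chi (M \o f).
Proof.
rewrite /gmf_form [RHS]exchange_big/=; apply: eq_bigr => s _.
rewrite [RHS]exchange_big/=; apply: eq_bigr => t _.
rewrite -mulr_sumr; congr (_ * _).
under eq_bigr do rewrite summxE.
rewrite (bigA_distr_big _ (fun i j => M j (s i) (t i)))/=.
by apply: eq_bigl => f; apply/ffun_onP/forallP.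
Qed.

Lemma Re_gen_matrix_fun_sum (R : realType) (n k : nat) (G : {group 'S_n})
    (chi : 'S_n -> R[i]) (M : 'I_k -> 'M[R[i]]_n) (Q : pred 'I_k) :
  linear_character G chi ->
  complex.Re (gen_matrix_fun G chi (\sum_(j | Q j) M j)) =
  \sum_(f : {ffun 'I_n -> 'I_k} | [forall i, Q (f i)])
     complex.Re (gmf_form G chi (M \o f) / #|G|%:R).
Proof.
move=> hchi; rewrite -raddf_sum/= -mulr_suml -gmf_form_sum gmf_formE//.
by rewrite mulrAC mulfV ?mul1r// pnatr_eq0 -lt0n cardG_gt0.
Qed.

Lemma Re_gmf_form_ge0 (R : realType) (n : nat) (G : {group 'S_n})
    (chi : 'S_n -> R[i]) (F : 'I_n -> 'M[R[i]]_n) :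
  (forall i, psdmx (F i)) -> 0 <= complex.Re (gmf_form G chi F / #|G|%:R).
Proof.
move=> hF.
have : 0 <= gmf_form G chi F / #|G|%:R.
  rewrite divr_ge0 ?ler0n//.
  exact: (@psd_tensor_form_ge0 R _ (mem G) n n F (fun s : 'S_n => s) chi).
by rewrite lecE => /andP[].
Qed.

(** This reduces the condition on a word to one boolean per letter, ready for case analysis. *)
Lemma word_avoidE (n k : nat) (f : {ffun 'I_n -> 'I_k}) (E : seq 'I_k) :
  [forall i, f i \notin E] = all (fun j => [forall i, f i != j]) E.
Proof.
apply/forallP/allP => [h j jE|h i].
  by apply/forallP => i; apply: contraTneq jE => <-; exact: h.
apply/negP => /h /forallP/(_ i).
by rewrite eqxx.
Qed.

Lemma word_uses_letter (n : nat) (f : {ffun 'I_n -> 'I_3}) : (0 < n)%N ->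
  [&& [forall i, f i != 0], [forall i, f i != 1] & [forall i, f i != 2]] = false.
Proof.
move=> n0; have := word_avoidE f [:: 0; 1; 2]; rewrite /= andbT => <-.
apply/negP => /forallP/(_ (Ordinal n0)).
by case: (f _) => [[|[|[|]]]].
Qed.

(** The coefficients of each [p f] are compared. In the last inequality they agree unless [f] uses
    all three letters, when only [D [::]] counts it. Since [0 < n], no word avoids every letter. *)
Lemma word_inclusion_exclusion (R : realType) (n : nat)
    (p : {ffun 'I_n -> 'I_3} -> R) (D : seq 'I_3 -> R) :
  (0 < n)%N -> (forall f, 0 <= p f) ->
  (forall E, D E = \sum_(f : {ffun 'I_n -> 'I_3} | [forall i, f i \notin E]) p f) ->
  [/\ D [:: 1; 2] + D [:: 0; 2] <= D [:: 2],
      D [:: 1; 2] + D [:: 0; 1] <= D [:: 1],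
      D [:: 0; 2] + D [:: 0; 1] <= D [:: 0] &
      D [:: 2] + D [:: 1] + D [:: 0] <=
        D [::] + D [:: 1; 2] + D [:: 0; 2] + D [:: 0; 1]].
Proof.
move=> n0 p0 DE.
have {}DE E : D E =
    \sum_(f : {ffun 'I_n -> 'I_3})
      (if all (fun j => [forall i, f i != j]) E then p f else 0).
  by rewrite DE big_mkcond; apply: eq_bigr => f _; rewrite word_avoidE.
rewrite !DE -!big_split/=.
by split; apply: ler_sum => f _; have := p0 f; have := word_uses_letter f n0;
  rewrite /= ?andbT; do 3![case: [forall i, _]] => //= *; lra.
Qed.

Theorem theorem2p1 (R : realType) (n : nat) (hn : (1 <= n)%N)
    (A B C : 'M[R[i]]_n) (hA : psdmx A) (hB : psdmx B) (hC : psdmx C)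
    (r : R) (hr : r = 1 \/ 2 <= r)
    (G : {group 'S_n}) (chi : 'S_n -> R[i]) (hchi : linear_character G chi) :
  let d (X : 'M[R[i]]_n) : R := complex.Re (gen_matrix_fun G chi X) in
  d (A + B + C) `^ r + d A `^ r + d B `^ r + d C `^ r
    >= d (A + B) `^ r + d (A + C) `^ r + d (B + C) `^ r.
Proof.
cbv zeta; pose d (X : 'M[R[i]]_n) : R := complex.Re (gen_matrix_fun G chi X).
pose M : 'I_3 -> 'M[R[i]]_n := tnth [tuple A; B; C].
have hM j : psdmx (M j) by case: j => [[|[|[|]]] //= ?]; rewrite /M /tnth.
pose p (f : {ffun 'I_n -> 'I_3}) := complex.Re (gmf_form G chi (M \o f) / #|G|%:R).
have p0 f : 0 <= p f by apply: Re_gmf_form_ge0 => i; exact: hM.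
(* [E] lists the omitted letters: [D [:: 1; 2]] is [d A], [D [:: 2]] is [d (A + B)], and [D [::]] is
   [d (A + B + C)]. *)
pose D (E : seq 'I_3) := d (\sum_(j | j \notin E) M j).
have DE E : D E = \sum_(f : {ffun 'I_n -> 'I_3} | [forall i, f i \notin E]) p f.
  exact: Re_gen_matrix_fun_sum.
have pos E : 0 <= D E by rewrite DE sumr_ge0.
have := word_inclusion_exclusion hn p0 DE.
have := pos [:: 1; 2]; have := pos [:: 0; 2]; have := pos [:: 0; 1].
rewrite /D ![\sum_(j | _) M j]big_mkcond/= !big_ord_recl !big_ord0/=.
rewrite /M /tnth/= ?addr0 ?add0r ?addrA => c0 b0 a0 [h1 h2 h3 h4].
exact: powR_hlawka_superadditive.
Qed.
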